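(* Let $\Phi$ be a homogeneous Poisson point process on $\mathbb{R}^2$ with intensity $\lambda>0$, and let $\boldsymbol{x}_{\rm s},\boldsymbol{x}_{\rm d}\in\mathbb{R}^2$ be two points at Euclidean distance $2d$ with $d>0$. Let $\widehat{s}(\boldsymbol{x})=\max\{\|\boldsymbol{x}_{\rm s}-\boldsymbol{x}\|,\|\boldsymbol{x}-\boldsymbol{x}_{\rm d}\|\}$ and, for $T\ge 0$, let $$N_{\rm FB}=\sum_{\boldsymbol{X}\in\Phi}\mathbf{1}_{\{\widehat{s}(\boldsymbol{X})\le T\}}.$$ Then for every $T\ge 0$, $N_{\rm FB}$ is a Poisson distributed random variable whose mean $\mu(T)=\mathsf{E}[N_{\rm FB}]$ is $$\mu(T)=\begin{cases}0 & \text{if }T<d,\\ \lambda\pi T^2-2d\lambda\sqrt{T^2-d^2}-2T^2\lambda\arctan\left(\frac{d}{\sqrt{T^2-d^2}}\right) & \text{if }T\ge d.\end{cases}$$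
   Context: $\|\cdot\|$ is the Euclidean norm; $\mathbf{1}_{\{\cdot\}}$ is an indicator function. $N_{\rm FB}$ is the number of relays (points of $\Phi$) that feed back their channel quality indicator $\widehat{s}(\boldsymbol{X})$ when each relay feeds back if and only if its indicator is at most the threshold $T$. A Poisson variable of mean $0$ is the constant $0$. At $T=d$ the expression $\arctan(d/0)$ is read as $\pi/2$. *)

(* Defs.v *)
From HB Require Import structures.
From mathcomp Require Import all_boot all_order all_algebra.
From mathcomp Require Import all_classical all_reals all_analysis.
From mathcomp Require Import measurable_realfun.

Set Implicit Arguments.
Unset Strict Implicit.
Unset Printing Implicit Defensive.

Import Order.TTheory GRing.Theory Num.Theory.
Import numFieldNormedType.Exports.

Local Open Scope classical_set_scope.
Local Open Scope ring_scope.

(* The library's norm on [R * R] is the max norm; this is the Euclidean one. *)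
Definition enorm {R : realType} (x : R * R) : R :=
  Num.sqrt (x.1 ^+ 2 + x.2 ^+ 2).

Definition area {R : realType} (B : set (R * R)) : \bar R :=
  (lebesgue_measure \x lebesgue_measure)%E B.

(* Counts are extended-real valued so that infinite counts need no junk value.
   The law is compared with the image of [poisson_prob m] under the inclusion
   of [nat] in [\bar R]; the second argument of [poisson_prob] is a dummy, and
   [poisson_prob 0] is the Dirac mass at 0. *)
Definition poisson_distributed {dO} {Omega : measurableType dO} {R : realType}
    (P : probability Omega R) (N : Omega -> \bar R) (m : R) : Prop :=
  [/\ 0 <= m,
      measurable_fun [set: Omega] N &
      forall A : set (\bar R), measurable A ->
        P (N @^-1` A) = poisson_prob m 0 [set k : nat | A (k%:R)%:E] ].

(* The events [A i] may be the full space, so the product rule over the whole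
   index set gives it over every subfamily. *)
Definition mutually_independent {dO} {Omega : measurableType dO} {R : realType}
    (P : probability Omega R) (n : nat) (N : 'I_n -> Omega -> \bar R) : Prop :=
  forall A : 'I_n -> set (\bar R), (forall i, measurable (A i)) ->
    P [set w | forall i, A i (N i w)] = (\prod_(i < n) P (N i @^-1` A i))%E.

Definition point_count {Omega : Type} {R : realType}
    (Phi : Omega -> set (R * R)) (B : set (R * R)) (w : Omega) : \bar R :=
  counting (Phi w `&` B).

(* A point process is a random locally finite set of points; its measurability
   is that of all the counts. [bounded_set] refers to the max norm, which has
   the same bounded sets as the Euclidean one. *)
Definition point_process {dO} {Omega : measurableType dO} {R : realType}
    (Phi : Omega -> set (R * R)) : Prop :=
  (forall w (B : set (R * R)), bounded_set B -> finite_set (Phi w `&` B)) /\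
  (forall B : set (R * R), measurable B ->
     measurable_fun [set: Omega] (point_count Phi B)).

Definition homogeneous_poisson_process
    {dO} {Omega : measurableType dO} {R : realType}
    (P : probability Omega R) (lambda : R) (Phi : Omega -> set (R * R)) : Prop :=
  [/\ point_process Phi,
      forall B : set (R * R), measurable B -> bounded_set B ->
        poisson_distributed P (point_count Phi B) (lambda * fine (area B)) &
      forall (n : nat) (B : 'I_n -> set (R * R)),
        (forall i, measurable (B i)) -> (forall i, bounded_set (B i)) ->
        trivIset [set: 'I_n] B ->
        mutually_independent P (fun i => point_count Phi (B i)) ].

Definition s_hat {R : realType} (xs xd x : R * R) : R :=
  Num.max (enorm (xs - x)) (enorm (x - xd)).

Definition N_FB {Omega : Type} {R : realType} (Phi : Omega -> set (R * R))
    (xs xd : R * R) (T : R) (w : Omega) : \bar R :=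
  \esum_(x in Phi w) (\1_[set y | s_hat xs xd y <= T] x)%:E.

(* [arctan (a / b)] with the convention [arctan (a / 0) = pi / 2] for [a > 0];
   the library has [a / 0 = 0]. *)
Definition atan_ratio {R : realType} (a b : R) : R :=
  if b == 0 then pi / 2 else atan (a / b).

Definition mu_FB {R : realType} (lambda d T : R) : R :=
  if T < d then 0
  else lambda * pi * T ^+ 2
       - 2 * d * lambda * Num.sqrt (T ^+ 2 - d ^+ 2)
       - 2 * T ^+ 2 * lambda * atan_ratio d (Num.sqrt (T ^+ 2 - d ^+ 2)).

(* Main.v *)
(* N_FB counts the points of Phi in the lens where two disks of radius T centred
   at xs and xd overlap, so it is Poisson with mean lambda times the area of the
   lens. A rigid motion, realised by three shears so that Fubini and translation
   invariance on the line suffice, moves the centres to (-d, 0) and (d, 0). The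
   area is then the integral of 2 (sqrt (T^2 - y^2) - d) over |y| <= h, with
   h = sqrt (T^2 - d^2); since h < T, the antiderivative
   y sqrt (T^2 - y^2) + T^2 atan (y / sqrt (T^2 - y^2)) - 2 d y is smooth on the
   closed interval. *)
From HB Require Import structures.
Require Import Defs.
From mathcomp Require Import all_boot all_order all_algebra.
From mathcomp Require Import all_classical all_reals all_analysis.
From mathcomp Require Import measurable_realfun.
From mathcomp Require Import ring lra.
Import Order.TTheory GRing.Theory Num.Theory.
Import numFieldNormedType.Exports.
Local Open Scope classical_set_scope.
Local Open Scope ring_scope.

(** * Invariance of area under shears and rigid motions *)

Lemma lebesgue_measure_translate (R : realType) (a : R) (A : set R) :
  measurable A ->
  lebesgue_measure ((fun x => x + a) @^-1` A) = lebesgue_measure A.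
Proof.
move=> mA; rewrite -[LHS]/(pushforward lebesgue_measure (fun x : R => x + a) A).
have mf : measurable_fun [set: measurableTypeR R] (fun x : measurableTypeR R => x + a : measurableTypeR R).
  by apply: measurable_funD.
pose f : {mfun measurableTypeR R >-> measurableTypeR R} := HB.pack (fun x : measurableTypeR R => x + a : measurableTypeR R) (isMeasurableFun.Build _ _ _ _ _ mf).
rewrite -[LHS]/(pushforward lebesgue_measure f A).
apply/esym/lebesgue_measure_unique => //= _ [[u v]] _ <-.
rewrite /pushforward.
rewrite (_ : _ @^-1` _ = `]u - a, v - a]%classic); last first.
  by apply/seteqP; split => x /=; rewrite !in_itv/= ltrBlDr lerBrDr.
by rewrite !lebesgue_measure_itv/= !lte_fin ltrD2r -!EFinB opprB addrA subrK.
Qed.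

Section shear.
Context {R : realType}.
Implicit Types (g : R -> R) (A : set (R * R)).

(** [area] integrates vertical slices; uniqueness of the product measure allows horizontal ones. *)
Lemma area_ysection A : measurable A ->
  area A = (\int[lebesgue_measure]_y lebesgue_measure (ysection A y))%E.
Proof.
move=> mA; rewrite /area.
rewrite (@product_measure_unique _ _ _ _ _ _ _ (lebesgue_measure \x^ lebesgue_measure)%E)//.
by move=> *; rewrite /= product_measure2E.
Qed.

Lemma measurable_shear1 g : measurable_fun setT g ->
  measurable_fun setT (fun p : R * R => (p.1 + g p.2, p.2)).
Proof.
move=> mg; apply/measurable_fun_pair => //=; apply: measurable_funD => //.
exact: measurableT_comp.
Qed.

Lemma measurable_shear2 g : measurable_fun setT g ->
  measurable_fun setT (fun p : R * R => (p.1, p.2 + g p.1)).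
Proof.
move=> mg; apply/measurable_fun_pair => //=; apply: measurable_funD => //.
exact: measurableT_comp.
Qed.

(** The horizontal slice at height [y] is merely translated, by [g y]. *)
Lemma area_shear1 g A : measurable_fun setT g -> measurable A ->
  area ((fun p => (p.1 + g p.2, p.2)) @^-1` A) = area A.
Proof.
move=> mg mA; rewrite !area_ysection//; last first.
  by rewrite -[X in measurable X]setTI; exact: measurable_shear1.
apply: eq_integral => y _.
rewrite -[RHS](lebesgue_measure_translate _ (g y)); last exact: measurable_ysection.
by rewrite !ysectionE.
Qed.

Lemma area_shear2 g A : measurable_fun setT g -> measurable A ->
  area ((fun p => (p.1, p.2 + g p.1)) @^-1` A) = area A.
Proof.
move=> mg mA; apply: eq_integral => x _ /=.
rewrite -[RHS](lebesgue_measure_translate _ (g x)); last exact: measurable_xsection.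
by rewrite !xsectionE.
Qed.

(* A rotation by an angle in [-pi/2, pi/2] is a product of three shears, with
   [t] the tangent of the half angle; the last two absorb the translation. *)
Lemma area_rigid (c s : R) (m : R * R) A : 0 <= c -> c ^+ 2 + s ^+ 2 = 1 ->
  measurable A ->
  area ((fun p => (c * p.1 - s * p.2 + m.1, s * p.1 + c * p.2 + m.2)) @^-1` A)
  = area A.
Proof.
move=> c0 cs1 mA; pose t := s / (1 + c).
have tc : t * (1 + c) = s by rewrite divfK// gt_eqF// ltr_wpDr.
(* This is [s ^+ 2 = (1 - c) * (1 + c)] divided by [1 + c]. *)
have ts : t * s = 1 - c.
  apply: (mulIf (_ : 1 + c != 0)); first by rewrite gt_eqF// ltr_wpDr.
  by rewrite mulrAC tc -expr2 -[_ ^+ 2](addKr (c ^+ 2)) cs1; ring.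
pose g1 y := - t * y; pose g2 x := s * x + m.2.
(* [g2] has already added [m.2], so [g3] takes it off before shearing. *)
pose g3 y := - t * (y - m.2) + m.1.
have mg1 : measurable_fun setT g1 by exact: measurable_funM.
have mg2 : measurable_fun setT g2 by apply: measurable_funD => //; exact: measurable_funM.
have mg3 : measurable_fun setT g3.
  by apply: measurable_funD => //; apply: measurable_funM => //; exact: measurable_funB.
pose A3 := (fun p : R * R => (p.1 + g3 p.2, p.2)) @^-1` A.
have mA3 : measurable A3.
  by rewrite -[A3]setTI; exact: measurable_shear1.
pose A2 := (fun p : R * R => (p.1, p.2 + g2 p.1)) @^-1` A3.
have mA2 : measurable A2.
  by rewrite -[A2]setTI; exact: measurable_shear2.
transitivity (area A3); last exact: area_shear1.
transitivity (area A2); last exact: area_shear2.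
transitivity (area ((fun p => (p.1 + g1 p.2, p.2)) @^-1` A2));
  last exact: area_shear1.
apply: (congr1 (fun f => area (f @^-1` A))).
apply/funext => -[x y] /=; rewrite /g1 /g2 /g3; congr pair.
  (* The first coordinate also needs [s = t * (1 + c)], for its coefficient of [y]. *)
  have -> : c = 1 - t * s by rewrite ts; ring.
  rewrite -{2}tc.
  have -> : c = 1 - t * s by rewrite ts; ring.
  by ring.
have -> : c = 1 - t * s by rewrite ts; ring.
by ring.
Qed.
End shear.

(** * The mean of a Poisson law *)

Lemma integral_nat_measure (R : realType) (mu : {measure set nat -> \bar R})
    (f : nat -> \bar R) : (forall k, 0 <= f k)%E ->
  (\int[mu]_k f k = \sum_(0 <= k <oo) f k * mu [set k])%E.
Proof.
move=> f0.
have -> : [set: nat] = \bigcup_k [set k].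
  by apply/seteqP; split => // k _; exists k.
rewrite ge0_integral_bigcup//; last first.
  by move=> i j _ _ [k [/= <- <-]].
apply: eq_eseriesr => k _.
rewrite (eq_integral (fun=> f k)); last by move=> i; rewrite inE => /= ->.
by rewrite integral_cst.
Qed.

Lemma poisson_prob_set1 (R : realType) (m : R) (k : nat) : 0 < m ->
  poisson_prob m 0 [set k] = (poisson_pmf m k)%:E.
Proof.
by move=> m0; rewrite /poisson_prob m0 esum_set1// lee_fin poisson_pmf_ge0.
Qed.

(** For [m > 0], the identity [(k + 1) p(k + 1) = m p(k)] for the mass function [p] turns the mean
    into [m] times the total mass 1. *)
Lemma poisson_prob_mean (R : realType) (m : R) : 0 <= m ->
  (\int[poisson_prob m 0]_k (k%:R)%:E = m%:E)%E.
Proof.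
rewrite le_eqVlt => /predU1P[<-|m0].
  rewrite (eq_measure_integral (\d_0%N)).
    by rewrite integral_dirac//= diracT mul1e.
  by move=> A _ _; rewrite /= /poisson_prob ltxx.
rewrite integral_nat_measure; last by move=> k; rewrite lee_fin.
(* The term at 0 vanishes; the index is then shifted by one. *)
rewrite nneseries_recl// mul0e add0e.
rewrite (eq_eseriesr (g := fun k => (k%:R)%:E * (poisson_pmf m k)%:E)%E); last first.
  by move=> k _; congr (_ * _)%E; exact: poisson_prob_set1.
rewrite -(@nneseries_addn _ _ 1)/=; last first.
  by move=> k; apply: mule_ge0; rewrite lee_fin// poisson_pmf_ge0.
have pmf_sum : (\sum_(0 <= k <oo) (poisson_pmf m k)%:E = 1)%E.
  rewrite -[RHS](probability_setT (poisson_prob m 0)).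
  by rewrite /= /poisson_prob m0 nneseries_esumT// => k; rewrite lee_fin poisson_pmf_ge0.
transitivity (\sum_(0 <= k <oo) m%:E * (poisson_pmf m k)%:E)%E; last first.
  by rewrite nneseriesZl ?pmf_sum ?mule1// => k _; rewrite lee_fin poisson_pmf_ge0.
apply: eq_eseriesr => k _; rewrite -!EFinM; congr EFin.
rewrite /poisson_pmf m0 addn1 factS exprS natrM.
by field; rewrite addrC natr1 !pnatr_eq0 -lt0n fact_gt0.
Qed.

(** The law of [N] and the image of the Poisson law in [\bar R] agree on measurable sets, so
    integrals against them agree. *)
Lemma poisson_distributed_mean (R : realType) (dO : measure_display)
    (Omega : measurableType dO) (P : probability Omega R) (N : Omega -> \bar R)
    (m : R) : poisson_distributed P N m -> (forall w, 0 <= N w)%E ->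
  (\int[P]_w N w = m%:E)%E.
Proof.
move=> [m0 mN NE] N0; rewrite -poisson_prob_mean//.
pose N' : {mfun Omega >-> \bar R} := HB.pack N (isMeasurableFun.Build _ _ _ _ _ mN).
pose i : {mfun nat >-> \bar R} := HB.pack (fun k : nat => (k%:R : R)%:E)
  (isMeasurableFun.Build _ _ _ _ (fun k : nat => (k%:R : R)%:E) (fun _ _ _ => I)).
(* The absolute value is nonnegative on all of [\bar R], as the change of variables requires, and is
   the identity on the values taken. *)
transitivity (\int[pushforward P N']_x `|x|)%E.
  rewrite ge0_integral_pushforward//.
  by apply: eq_integral => w _ /=; rewrite gee0_abs.
transitivity (\int[pushforward (poisson_prob m 0) i]_x `|x|)%E.
  by apply: eq_measure_integral => A mA _; exact: NE.
rewrite ge0_integral_pushforward//.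
by apply: eq_integral => k _ /=; rewrite normr_nat.
Qed.

(** * The feedback count as a point count in a bounded measurable set *)

Lemma esum_indic (R : realType) (T : choiceType) (A B : set T) :
  finite_set (A `&` B) ->
  (\esum_(x in A) (\1_B x : R)%:E = counting (A `&` B))%E.
Proof.
move=> finAB.
transitivity (\esum_(x in A `&` B) 1%:E : \bar R)%E.
  rewrite esum_mkcondr; apply: eq_esum => x _.
  by rewrite indicE; case: (x \in B).
by rewrite esum_fset// /counting asboolT// card_fset_sum1 natr_sum -sumEFin fsbig_finite.
Qed.

Section s_hat_sublevel.
Context {R : realType}.
Implicit Types (xs xd x v : R * R) (T : R).

Lemma enorm_le v T : 0 <= T -> (enorm v <= T) = (v.1 ^+ 2 + v.2 ^+ 2 <= T ^+ 2).
Proof.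
move=> T0; rewrite -(@ler_pXn2r _ 2) ?nnegrE// ?sqrtr_ge0//.
by rewrite sqr_sqrtr// addr_ge0// sqr_ge0.
Qed.

Lemma measurable_s_hat xs xd : measurable_fun setT (s_hat xs xd).
Proof.
have menorm (f : R * R -> R * R) : measurable_fun setT f ->
    measurable_fun setT (fun x : R * R => enorm (f x)).
  move=> mf; pose g x := (f x).1 ^+ 2 + (f x).2 ^+ 2.
  have mg : measurable_fun setT g.
    apply: measurable_funD; apply: measurable_funX.
      exact: (measurableT_comp measurable_fst mf).
    exact: (measurableT_comp measurable_snd mf).
  have ms : measurable_fun setT (Num.sqrt : R -> R).
    by apply: continuous_measurable_fun; exact: sqrt_continuous.
  exact: (measurableT_comp ms mg).
apply: measurable_maxr; apply: menorm; apply/measurable_fun_pair => /=;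
  exact: measurable_funB.
Qed.

Lemma measurable_s_hat_le xs xd T : measurable [set x | s_hat xs xd x <= T].
Proof.
rewrite (_ : [set _ | _] = s_hat xs xd @^-1` `]-oo, T]%classic); last first.
  by apply/seteqP; split => x /=; rewrite in_itv.
by rewrite -[X in measurable X]setTI; exact: measurable_s_hat.
Qed.

(** Each coordinate of a point of the set is within [T] of that of [xs], which bounds the max
    norm. *)
Lemma bounded_s_hat_le xs xd T : 0 <= T ->
  bounded_set [set x | s_hat xs xd x <= T].
Proof.
move=> T0; exists (Num.max `|xs.1| `|xs.2| + T); split; first exact: num_real.
move=> M ltM x /=; rewrite ge_max enorm_le// => /andP[+ _] /=.
have leT (a b : R) : a ^+ 2 + b ^+ 2 <= T ^+ 2 -> `|a| <= T.
  move=> abT; rewrite -(@ler_pXn2r _ 2) ?nnegrE// real_normK ?num_real//.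
  by rewrite (le_trans _ abT)// lerDl sqr_ge0.
have bnd (u v : R) : `|u - v| <= T -> `|v| <= `|u| + T.
  move=> uvT; rewrite -[v](subKr u) (le_trans (ler_normB _ _))//.
  by rewrite lerD2l.
move=> xT; apply/(le_trans _ (ltW ltM)); rewrite prod_normE ge_max/=.
apply/andP; split.
  by rewrite (le_trans (bnd _ _ (leT _ _ xT)))// lerD2r le_max lexx.
rewrite addrC in xT.
by rewrite (le_trans (bnd _ _ (leT _ _ xT)))// lerD2r le_max lexx orbT.
Qed.
End s_hat_sublevel.

(** * The area of the lens in symmetric position *)

Lemma atanV (R : realType) (x : R) : 0 < x -> atan x^-1 = pi / 2 - atan x.
Proof.
move=> x0; have a0 : 0 < atan x by rewrite -(@atan0 R) lt_atan.
have a1 := atan_ltpi2 x.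
have -> : x^-1 = tan (pi / 2 - atan x).
  rewrite /tan sinB cosB sin_pihalf cos_pihalf !mul0r !mul1r add0r subr0.
  by rewrite -[x in LHS]atanK /tan invf_div.
by rewrite tanK// in_itv/=; apply/andP; split; lra.
Qed.

Section disk_area.
Context {R : realType}.
Context (T : R).
Let w (y : R) := Num.sqrt (T ^+ 2 - y ^+ 2).

(** The [atan] is the arcsine of [y / T]: the function is the signed area of the disk of radius [T]
    between heights 0 and [y]. *)
Lemma is_derive_disk_area (y : R) : 0 < T -> `|y| < T ->
  is_derive y 1 (fun y => y * w y + T ^+ 2 * atan (y / w y)) (2 * w y).
Proof.
move=> T0 yT.
have Ty : 0 < T ^+ 2 - y ^+ 2.
  rewrite subr_gt0 -[y ^+ 2]real_normK ?num_real// ltr_pXn2r ?nnegrE//; exact: ltW.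
have wy : 0 < w y by rewrite /w sqrtr_gt0.
have w2 : w y ^+ 2 = T ^+ 2 - y ^+ 2 by rewrite /w sqr_sqrtr// ltW.
have dw : is_derive y 1 w (- y / w y).
  have d1 : is_derive y 1 (fun y => T ^+ 2 - y ^+ 2) (- (2 * y)).
    by apply: is_derive_eq; rewrite /GRing.scale/=; ring.
  have := @is_derive1_comp _ Num.sqrt (fun y => T ^+ 2 - y ^+ 2) _ _ _ (is_derive1_sqrt Ty) d1.
  move/is_derive_eq; apply; rewrite -/(w y).
  by field; rewrite gt_eqF.
have dq : is_derive y 1 (fun y => y / w y) (T ^+ 2 / w y ^+ 3).
  have wN : w y != 0 by rewrite gt_eqF.
  have dV := is_deriveV wN dw.
  have := is_deriveM (is_derive_id y 1) dV.
  move/is_derive_eq; apply.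
  (* Eliminating [T] leaves a rational identity in [y] and [w y]. *)
  rewrite /GRing.scale/= (_ : T ^+ 2 = w y ^+ 2 + y ^+ 2); last by rewrite w2; ring.
  by field.
have da := @is_derive1_comp _ atan (fun y => y / w y) _ _ _ (is_derive1_atan _) dq.
have := is_deriveD (is_deriveM (is_derive_id y 1) dw) (is_deriveZ (T ^+ 2) da).
move/is_derive_eq; apply.
rewrite /GRing.scale/= (_ : T ^+ 2 = w y ^+ 2 + y ^+ 2); last by rewrite w2; ring.
by field; rewrite (gt_eqF wy) gt_eqF// ltr_pwDl ?exprn_gt0 ?sqr_ge0.
Qed.
End disk_area.

(** The farther of the centres [(-d, 0)] and [(d, 0)] lies at horizontal distance [|p.1| + d]. The
    slice at height [y] is [|x| <= w y - d], nonempty exactly when [|y| <= h]. *)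
Lemma lens_area (R : realType) (d T : R) : 0 < d -> d <= T ->
  area [set p : R * R | (`|p.1| + d) ^+ 2 + p.2 ^+ 2 <= T ^+ 2] =
  (2 * T ^+ 2 * (pi / 2 - atan_ratio d (Num.sqrt (T ^+ 2 - d ^+ 2)))
   - 2 * d * Num.sqrt (T ^+ 2 - d ^+ 2))%:E.
Proof.
move=> d0 dT; set L := [set _ | _]; set h := Num.sqrt (T ^+ 2 - d ^+ 2).
have T0 : 0 < T by exact: lt_le_trans dT.
have h0 : 0 <= h by exact: sqrtr_ge0.
have h2 : h ^+ 2 = T ^+ 2 - d ^+ 2.
  by rewrite sqr_sqrtr// subr_ge0 ler_pXn2r ?nnegrE// ltW.
have hT : h < T.
  by rewrite -(@ltr_pXn2r _ 2) ?nnegrE// ?(ltW T0)// h2 gtrBl exprn_gt0.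
clearbody h.
pose w (y : R) : R := Num.sqrt (T ^+ 2 - y ^+ 2).
have mL : measurable L.
  rewrite (_ : L = (fun p => (`|p.1| + d) ^+ 2 + p.2 ^+ 2) @^-1` `]-oo, T ^+ 2]%classic); last first.
    by apply/seteqP; split => x /=; rewrite in_itv.
  rewrite -[X in measurable X]setTI.
  suff mf : measurable_fun setT (fun p : R * R => (`|p.1| + d) ^+ 2 + p.2 ^+ 2) by exact: mf.
  apply: measurable_funD; apply: measurable_funX => //.
  by apply: measurable_funD => //; exact: measurableT_comp.
have wh (y : R) : `|y| <= h -> d <= w y.
  move=> yh; have yh2 : y ^+ 2 <= h ^+ 2.
    by rewrite -[y ^+ 2]real_normK ?num_real// ler_pXn2r ?nnegrE.
  rewrite -(@ler_pXn2r _ 2) ?nnegrE ?sqrtr_ge0 ?(ltW d0)//.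
  have h2' := h2; rewrite sqr_sqrtr; first by nra.
  by nra.
have slice (y : R) : lebesgue_measure (ysection L y) =
    ((fun y => (2 * w y - 2 * d)%:E) \_ `[- h, h]) y.
  rewrite patchE mem_setE in_itv/= -ler_norml.
  case: ifPn => [yh|yh].
    rewrite (_ : ysection L y = `[- (w y - d), w y - d]%classic); last first.
      have yh2 : y ^+ 2 <= h ^+ 2.
        by rewrite -[y ^+ 2]real_normK ?num_real// ler_pXn2r ?nnegrE.
      have Ty : 0 <= T ^+ 2 - y ^+ 2 by have h2' := h2; nra.
      have E x : ((`|x| + d) ^+ 2 + y ^+ 2 <= T ^+ 2) = (`|x| <= w y - d).
        rewrite [RHS]lerBrDr -[RHS](@ler_pXn2r _ 2) ?nnegrE ?sqrtr_ge0 ?addr_ge0 ?(ltW d0)//.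
        by rewrite sqr_sqrtr// lerBrDr.
      by apply/seteqP; split => x; rewrite ysectionE /L /= in_itv/= -ler_norml E.
    rewrite lebesgue_measure_itv/= lte_fin.
    have := wh _ yh; case: ifPn => [_ _|].
      by rewrite -EFinB; congr EFin; ring.
    (* The slice is one point here: [w y = d], and both lengths are 0. *)
    by rewrite -leNgt => h1 h3; congr EFin; lra.
  rewrite (_ : ysection L y = set0) ?measure0//.
  rewrite -subset0 => x; rewrite ysectionE /L /=; apply/negP; rewrite -ltNge.
  move: yh; rewrite -ltNge => yh.
  (* Above height [h], [(a + d) ^+ 2 + y ^+ 2 > d ^+ 2 + h ^+ 2 = T ^+ 2]. *)
  have yh2 : h ^+ 2 < y ^+ 2.
    by rewrite -[y ^+ 2]real_normK ?num_real// ltr_pXn2r ?nnegrE.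
  have := normr_ge0 x; move: (`|x|) => a a0; have h2' := h2.
  have := mulr_ge0 a0 (ltW d0); nra.
rewrite area_ysection//.
transitivity (\int[lebesgue_measure]_(y in `[(- h)%R, h]) (2 * w y - 2 * d)%:E)%E.
  by rewrite [RHS]integral_mkcond; apply: eq_integral => y _; exact: slice.

(* The case [T = d]: the lens has area 0, and the convention in [atan_ratio] makes the formula
   vanish too. *)
have [hE|hneq] := eqVneq h 0.
  rewrite hE oppr0 set_itv1 integral_set1 /atan_ratio eqxx.
  by rewrite subrr !mulr0 subr0.
have hgt0 : 0 < h by rewrite lt_def hneq.
pose F : R -> R := (fun y => (y * w y + T ^+ 2 * atan (y / w y)) - 2 * d * y).
have cw : continuous w.
  move=> y; have cq : {for y, continuous (fun y : R => T ^+ 2 - y ^+ 2)}.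
    by apply: cvgB; [exact: cvg_cst|exact: exprn_continuous].
  exact: (continuous_comp cq (@sqrt_continuous R _)).
have cg : continuous (fun y : R => 2 * w y - 2 * d).
  move=> y; apply: cvgB; last exact: cvg_cst.
  by apply: cvgM; [exact: cvg_cst|exact: cw].
have dF (y : R) : `|y| < T -> is_derive y 1 F (2 * w y - 2 * d).
  move=> yT; have := is_deriveB (is_derive_disk_area T y T0 yT) (is_deriveZ (2 * d) (is_derive_id y 1)).
  by move/is_derive_eq; apply; rewrite /GRing.scale/= mulr1.
have cF (y : R) : `|y| < T -> {for y, continuous F}.
  move=> yT; apply/differentiable_continuous/derivable1_diffP.
  by have [] := dF _ yT.
have ltT (y : R) : `|y| <= h -> `|y| < T by move/le_lt_trans; exact.
rewrite (@continuous_FTC2 _ _ F).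
(* [F] is odd and [w h = d], so the integral is [2 * F h]; [atanV] turns [atan (h / d)] into the
   stated arctangent. *)
- have whd : w h = d by rewrite /w h2 subKr sqrtr_sqr gtr0_norm.
  rewrite /F (_ : w (- h) = w h); last by rewrite /w sqrrN.
  rewrite whd !mulNr atanN /atan_ratio (negPf hneq) -(invf_div d h) atanV ?divr_gt0//.
  by rewrite -EFinB; congr EFin; ring.
- by rewrite gtrN.
- by apply: continuous_subspaceT => y; exact: cg.
- split.
  + move=> y; rewrite in_itv/= => /andP[hy yh].
    have /dF[] : `|y| < T by apply: ltT; rewrite ler_norml !ltW.
    by [].
  + apply: cvg_at_right_filter; apply: cF; apply: ltT.
    by rewrite normrN ger0_norm.
  + apply: cvg_at_left_filter; apply: cF; apply: ltT.
    by rewrite ger0_norm.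
- move=> y; rewrite in_itv/= => /andP[hy yh].
  rewrite derive1E; apply: derive_val.
  apply: dF; apply: ltT; rewrite ler_norml !ltW//.
Qed.

(** * Reduction of the lens to symmetric position *)

Lemma area_s_hat_le (R : realType) (xs xd : R * R) (d T : R) :
  0 < d -> 0 <= T -> enorm (xs - xd) = 2 * d ->
  area [set x | s_hat xs xd x <= T] =
  area [set p : R * R | (`|p.1| + d) ^+ 2 + p.2 ^+ 2 <= T ^+ 2].
Proof.
(* Swapping the centres makes the cosine nonnegative, as [area_rigid] asks. *)
move=> d0 T0; wlog le1 : xs xd / xs.1 <= xd.1.
  move=> wlg; have [/wlg//|/ltW lex] := leP xs.1 xd.1.
  have enormN (v : R * R) : enorm (- v) = enorm v by rewrite /enorm !sqrrN.
  rewrite -enormN opprB => /(wlg _ _ lex) <-; congr area.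
  by apply/seteqP; split => x /=; rewrite /s_hat maxC -enormN opprB -(enormN (x - _)) opprB.
move=> dist; have dist2 : (xd.1 - xs.1) ^+ 2 + (xd.2 - xs.2) ^+ 2 = (2 * d) ^+ 2.
  rewrite -dist sqr_sqrtr ?addr_ge0 ?sqr_ge0//=; ring.
(* [(c, s)] is the unit vector from [xs] to [xd]; with the midpoint [m] as translation, the motion
   takes [(-d, 0)] to [xs] and [(d, 0)] to [xd]. *)
pose c := (xd.1 - xs.1) / (2 * d); pose s := (xd.2 - xs.2) / (2 * d).
have dN0 : d != 0 by rewrite gt_eqF.
have c0 : 0 <= c by rewrite divr_ge0 ?subr_ge0// mulr_ge0// ltW.
have cs1 : c ^+ 2 + s ^+ 2 = 1.
  by rewrite !expr_div_n -mulrDl dist2 divff// expf_neq0// mulf_neq0// pnatr_eq0.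
pose m := ((xs.1 + xd.1) / 2, (xs.2 + xd.2) / 2).
rewrite -(@area_rigid _ c s m)//; last exact: measurable_s_hat_le.
have cE : xd.1 - xs.1 = 2 * d * c by rewrite /c mulrC divfK// mulf_neq0// pnatr_eq0.
have sE : xd.2 - xs.2 = 2 * d * s by rewrite /s mulrC divfK// mulf_neq0// pnatr_eq0.
have m1 : m.1 = xs.1 + d * c by rewrite /m/=; lra.
have m2 : m.2 = xs.2 + d * s by rewrite /m/=; lra.
have xd1 : xd.1 = xs.1 + 2 * d * c by rewrite -cE; ring.
have xd2 : xd.2 = xs.2 + 2 * d * s by rewrite -sE; ring.
rewrite m1 m2; clearbody c s.
have ns (x y : R) : (xs.1 - (c * x - s * y + (xs.1 + d * c))) ^+ 2 +
    (xs.2 - (s * x + c * y + (xs.2 + d * s))) ^+ 2 = (x + d) ^+ 2 + y ^+ 2.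
  by rewrite -[RHS]mul1r -cs1; ring.
have nd (x y : R) : (c * x - s * y + (xs.1 + d * c) - xd.1) ^+ 2 +
    (s * x + c * y + (xs.2 + d * s) - xd.2) ^+ 2 = (x - d) ^+ 2 + y ^+ 2.
  transitivity ((c ^+ 2 + s ^+ 2) * ((x - d) ^+ 2 + y ^+ 2)).
    by rewrite xd1 xd2; ring.
  by rewrite cs1 mul1r.
congr area; apply/seteqP; split => -[x y] /=;
  rewrite /s_hat ge_max !enorm_le//= ns nd.
  (* The sign of [x] decides which of [x + d] and [x - d] has absolute value [|x| + d]. *)
  by move=> /andP[h1 h2]; case: (ler0P x) => x0; nra.
by move=> h; apply/andP; split; move: h; case: (ler0P x) => x0; nra.
Qed.

Theorem theorem5 (R : realType) (dO : measure_display)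
    (Omega : measurableType dO) (P : probability Omega R)
    (lambda : R) (hlambda : 0 < lambda)
    (Phi : Omega -> set (R * R)) (hPhi : homogeneous_poisson_process P lambda Phi)
    (xs xd : R * R) (d : R) (hd : 0 < d) (hdist : enorm (xs - xd) = 2 * d)
    (T : R) (hT : 0 <= T) :
  poisson_distributed P (N_FB Phi xs xd T) (mu_FB lambda d T) /\
  (\int[P]_w N_FB Phi xs xd T w = (mu_FB lambda d T)%:E)%E.
Proof.
have [[finPhi _] poisPhi _] := hPhi.
pose B := [set x | s_hat xs xd x <= T].
have bB : bounded_set B by exact: bounded_s_hat_le.
have NE : N_FB Phi xs xd T = point_count Phi B.
  by apply/funext => w; apply: esum_indic; exact: finPhi.
have muE : mu_FB lambda d T = lambda * fine (area B).
  rewrite (area_s_hat_le R xs xd d T)// /mu_FB; case: ltP => [Td|dT].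
    (* For [T < d] the disks are disjoint: [(|x| + d) ^+ 2 >= d ^+ 2 > T ^+ 2]. *)
    rewrite (_ : [set _ | _] = set0) ?/area ?measure0 ?mulr0//.
    rewrite -subset0 => -[x y] /=; apply/negP; rewrite -ltNge.
    have := normr_ge0 x; move: (`|x|) => a a0; have := mulr_ge0 a0 (ltW hd).
    have := sqr_ge0 y; nra.
  by rewrite lens_area//=; field.
have poisN : poisson_distributed P (N_FB Phi xs xd T) (mu_FB lambda d T).
  by rewrite NE muE; apply: poisPhi => //; exact: measurable_s_hat_le.
split => //; apply: poisson_distributed_mean => // w.
by apply: esum_ge0 => x _; rewrite lee_fin.
Qed.
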